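(* Let $E$ be a real uniformly convex and smooth Banach space and let $K$ be a nonempty closed convex subset of $E$ with a sunny nonexpansive retraction $P:E\to K$. Let $T_1,T_2:K\to E$ be two weakly inward, nonself uniformly $L$-Lipschitzian, total asymptotically nonexpansive mappings with sequences $\{\mu_n\},\{\lambda_n\}$ and function $\phi$, such that $\sum_{n=1}^\infty \mu_n<\infty$ and $\sum_{n=1}^\infty\lambda_n<\infty$. Suppose that there exist $M,M^*>0$ such that $\phi(\kappa)\le M^*\kappa$ for all $\kappa\ge M$. Let $\{\alpha_n\}$ and $\{\beta_n\}$ be two real sequences in $[\varepsilon,1-\varepsilon]$ for some $\varepsilon\in(0,1)$. Suppose that $\{x_n\}$ is generated by $x_1\in K$ and, for $n\in\mathbb{N}$, $$x_{n+1}=(1-\alpha_n)(PT_1)^n y_n+\alpha_n (PT_2)^n y_n,\qquad y_n=(1-\beta_n)x_n+\beta_n(PT_1)^n x_n .$$ If $T_1$ and $T_2$ satisfy condition $(A')$ and $F=F(T_1)\cap F(T_2)\ne\emptyset$, then $\{x_n\}$ converges strongly to a common fixed point of $T_1$ and $T_2$.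
   Context: A nonexpansive retraction $P:E\to K$ of $E$ onto $K$ is a nonexpansive map ($\|Px-Py\|\le\|x-y\|$) with $Px=x$ for all $x\in K$; it is sunny if $P(Px+t(x-Px))=Px$ for all $x\in E$ and all $t\ge0$. For $T:K\to E$, $PT:K\to K$ is the composition $x\mapsto P(Tx)$ and $(PT)^n$ is its $n$-th iterate ($(PT)^0$ is the identity). Fixed point sets: $F(T)=\{x\in K: Tx=x\}$, and $d(x,F)=\inf_{p\in F}\|x-p\|$. $E$ is smooth if $\lim_{t\to0}\frac{\|x+ty\|-\|x\|}{t}$ exists for all $x,y$ with $\|x\|=\|y\|=1$. A nonself mapping $T:K\to E$ is called total asymptotically nonexpansive (with sequences $\{\mu_n\},\{\lambda_n\}$ and function $\phi$) if $\{\mu_n\},\{\lambda_n\}$ are nonnegative real sequences with $\mu_n,\lambda_n\to0$ as $n\to\infty$, $\phi:\mathbb{R}\to\mathbb{R}$ is a strictly increasing continuous function with $\phi(0)=0$, and $$\|(PT)^n x-(PT)^n y\|\le \|x-y\|+\mu_n\phi(\|x-y\|)+\lambda_n\quad\text{for all }x,y\in K,\ n\ge1.$$ When two mappings $T_1,T_2$ are considered, both satisfy this inequality with the same $\{\mu_n\},\{\lambda_n\},\phi$. $T:K\to E$ is uniformly $L$-Lipschitzian if there is a constant $L>0$ such that $\|T(PT)^{n-1}x-T(PT)^{n-1}y\|\le L\|x-y\|$ for all $x,y\in K$, $n\ge1$. $T:K\to E$ is weakly inward if for every $x\in K$, $Tx$ belongs to the closure of $I_K(x)=\{x+\lambda(u-x):u\in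 K,\ \lambda\ge1\}$. $T_1,T_2$ satisfy condition $(A')$ if there is a nondecreasing function $f:[0,\infty)\to[0,\infty)$ with $f(0)=0$ and $f(t)>0$ for all $t\in(0,\infty)$ such that $$\tfrac12\left(\|x-PT_1x\|+\|x-PT_2x\|\right)\ge f(d(x,F))\quad\text{for all }x\in K,$$ where $F=F(T_1)\cap F(T_2)$. *)

(* Defs.v *)
From HB Require Import structures.
From mathcomp Require Export all_boot all_order all_algebra.
From mathcomp Require Export all_classical all_reals all_analysis.
Export Order.TTheory GRing.Theory Num.Theory.
Export numFieldNormedType.Exports.

Set Implicit Arguments.
Unset Strict Implicit.
Unset Printing Implicit Defensive.

Global Open Scope classical_set_scope.
Global Open Scope ring_scope.

(* A map T : K -> E on a subset K of E is represented by a total T : E -> E of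
   which only the values on K are ever constrained or used; a map E -> K is a
   map E -> E with values in K.  As P maps into K, iter n (P \o T) x with x in
   K evaluates T on K only.  Sequences indexed by n >= 1 are functions on nat
   whose value at 0 is neither constrained nor used. *)

(* Clarkson's definition, on the unit sphere. *)
Definition uniformly_convex (R : realType) (E : normedModType R) : Prop :=
  forall eps : R, 0 < eps -> eps <= 2 ->
  exists2 delta : R, 0 < delta &
    forall x y : E, `|x| = 1 -> `|y| = 1 -> eps <= `|x - y| ->
      `|2^-1 *: (x + y)| <= 1 - delta.

Definition smooth (R : realType) (E : normedModType R) : Prop :=
  forall x y : E, `|x| = 1 -> `|y| = 1 ->
    cvg ((`|x + t *: y| - `|x|) / t @[t --> (0 : R)^']).

Definition nonexpansive_retraction (R : realType) (E : normedModType R)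
    (K : set E) (P : E -> E) : Prop :=
  [/\ forall x, K (P x),
      forall x y, `|P x - P y| <= `|x - y|
    & forall x, K x -> P x = x].

Definition sunny (R : realType) (E : normedModType R) (P : E -> E) : Prop :=
  forall (x : E) (t : R), 0 <= t -> P (P x + t *: (x - P x)) = P x.

Definition fixed_points (E : Type) (K : set E) (T : E -> E) : set E :=
  [set x | K x /\ T x = x].

(* inf is a junk value when A is empty. *)
Definition dist_set (R : realType) (E : normedModType R) (x : E) (A : set E) :
  R := inf [set `|x - p| | p in A].

Definition total_asymptotically_nonexpansive (R : realType)
    (E : normedModType R) (K : set E) (P : E -> E)
    (mu lambda : nat -> R) (phi : R -> R) (T : E -> E) : Prop :=
  [/\ forall n, (1 <= n)%N -> 0 <= mu n /\ 0 <= lambda n,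
      mu n @[n --> \oo] --> (0 : R) /\ lambda n @[n --> \oo] --> (0 : R),
      [/\ {homo phi : s t / s < t}, continuous phi & phi 0 = 0]
    & forall (x y : E) (n : nat), K x -> K y -> (1 <= n)%N ->
        `|iter n (P \o T) x - iter n (P \o T) y|
          <= `|x - y| + mu n * phi `|x - y| + lambda n].

Definition uniformly_lipschitzian (R : realType) (E : normedModType R)
    (K : set E) (P : E -> E) (L : R) (T : E -> E) : Prop :=
  0 < L /\
  forall (x y : E) (n : nat), K x -> K y -> (1 <= n)%N ->
    `|T (iter n.-1 (P \o T) x) - T (iter n.-1 (P \o T) y)| <= L * `|x - y|.

Definition inward_set (R : realType) (E : normedModType R) (K : set E)
    (x : E) : set E :=
  [set z | exists u : E, exists l : R,
     [/\ K u, 1 <= l & z = x + l *: (u - x)]].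

Definition weakly_inward (R : realType) (E : normedModType R) (K : set E)
    (T : E -> E) : Prop :=
  forall x, K x -> closure (inward_set K x) (T x).

(* f represents a map [0, +oo[ -> [0, +oo[: only its values on [0, +oo[ are
   constrained, and f >= 0 there follows from f 0 = 0 and positivity. *)
Definition condition_A' (R : realType) (E : normedModType R) (K : set E)
    (P T1 T2 : E -> E) : Prop :=
  exists f : R -> R,
    [/\ forall s t, 0 <= s -> s <= t -> f s <= f t,
        f 0 = 0,
        forall t, 0 < t -> 0 < f t
      & forall x, K x ->
          f (dist_set x (fixed_points K T1 `&` fixed_points K T2))
            <= 2^-1 * (`|x - P (T1 x)| + `|x - P (T2 x)|)].

(* Main.v *)
Require Import Defs.
From mathcomp Require Import ring lra.

(* Put S_i = P T_i and F = F(T_1) /\ F(T_2).  For p in F the sequence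
   D n = |x_n - p| satisfies D (n+1) <= exp (c_n) D n + d_n with c, d summable
   and independent of p, so D converges.  Uniform convexity (Schu's lemma),
   applied to the convex combinations defining x_(n+1) and y_n, gives
   |S_1^n y_n - S_2^n y_n| -> 0 and |x_n - S_1^n x_n| -> 0, whence
   |x_n - S_i x_n| -> 0 by the uniform Lipschitz bound.  Condition (A') turns
   this into d(x_n, F) -> 0, which makes x_n Cauchy, with limit in the closure
   of F.  F is closed because T_1 and T_2 themselves are Lipschitz on K, so the
   limit is fixed by T_1 and T_2 and not merely by P T_1 and P T_2. *)

Set Implicit Arguments.
Unset Strict Implicit.
Unset Printing Implicit Defensive.

(** * Uniform convexity: from midpoints on the sphere to convex combinations in balls *)

Section UniformConvexity.
Variables (R : realType) (E : normedModType R).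
Hypothesis ucE : uniformly_convex E.
Implicit Types (u v : E) (eta rho t : R).

(** If one vector has norm at most [1 - sigma], the triangle inequality already makes the midpoint
    short. Otherwise normalising moves each vector by at most [sigma], and the modulus on the sphere
    at distance [eta / 2] applies. *)
Lemma uniformly_convex_unit_ball eta : 0 < eta ->
  exists2 delta : R, 0 < delta &
    forall u v, `|u| <= 1 -> `|v| <= 1 -> eta <= `|u - v| ->
      `|2^-1 *: (u + v)| <= 1 - delta.
Proof.
move=> eta0.
(* Beyond 4 the claim is vacuous; otherwise [eta / 2] lies in the range covered by
   [uniformly_convex]. *)
have [eta4|eta4] := ltP 4 eta.
  exists 1 => // u v u1 v1 uv; have := ler_normB u v; lra.
have [e0 e2] : 0 < eta / 2 /\ eta / 2 <= 2 by lra.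
have [delta delta0 sphere] := ucE e0 e2.
(* The three bounds serve, in order, to absorb the normalisation error in the midpoint, to keep the
   normalised vectors [eta / 2] apart, and to keep both norms away from 0. *)
pose sigma := Num.min (delta / 2) (Num.min (eta / 4) 2^-1).
have sigma0 : 0 < sigma by rewrite !lt_min; apply/and3P; split; lra.
have [sd se s2] : [/\ sigma <= delta / 2, sigma <= eta / 4 & sigma <= 2^-1].
  by split; rewrite !ge_min lexx ?orbT.
have half u v : `|2^-1 *: (u + v)| <= 2^-1 * (`|u| + `|v|).
  by rewrite normrZ gtr0_norm ?invr_gt0// ler_pM2l ?invr_gt0// ler_normD.
exists (sigma / 2) => [|u v u1 v1 uv]; first by lra.
have [us|us] := leP `|u| (1 - sigma); first by have := half u v; lra.
have [vs|vs] := leP `|v| (1 - sigma); first by have := half u v; lra.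
pose nrm w : E := `|w|^-1 *: w.
have nrm1 w : 1 - sigma < `|w| -> `|nrm w| = 1.
  by move=> ws; rewrite normrZ normfV normr_id mulVf//; apply/eqP; lra.
have nrmB w : 1 - sigma < `|w| -> `|w| <= 1 -> `|nrm w - w| <= sigma.
  move=> ws w1; rewrite /nrm -[X in _ - X]scale1r -scalerBl normrZ.
  have w0 : 0 < `|w| by lra.
  rewrite -[X in _ * X]gtr0_norm// -normrM mulrBl mulVf ?gt_eqF// mul1r.
  by rewrite ger0_norm; lra.
have Du := nrmB u us u1; have Dv := nrmB v vs v1.
have far : eta / 2 <= `|nrm u - nrm v|.
  have := ler_distD (nrm u) u v; have := ler_distD (nrm v) (nrm u) v.
  by rewrite (distrC u (nrm u)); lra.
have := sphere _ _ (nrm1 _ us) (nrm1 _ vs) far.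
have -> : 2^-1 *: (u + v) =
    2^-1 *: (nrm u + nrm v) + - (2^-1 *: ((nrm u - u) + (nrm v - v))).
  by rewrite -scalerN -scalerDr opprD !opprB addrACA ![nrm _ + _]addrC !subrK.
have := half (nrm u - u) (nrm v - v).
have := ler_normD (2^-1 *: (nrm u + nrm v))
  (- (2^-1 *: ((nrm u - u) + (nrm v - v)))).
by rewrite normrN; lra.
Qed.

(** Rescaling by [rho] reduces the midpoint to the unit ball. For [t <= 1/2] the combination is
    itself a combination of [u] and the midpoint, with weight [2 * t >= 2 * eps] on the latter;
    larger [t] follows by exchanging [u] and [v]. *)
Lemma uniformly_convex_comb eps eta B : 0 < eps -> 0 < eta ->
  exists2 delta : R, 0 < delta &
    forall u v rho t, `|u| <= rho -> `|v| <= rho -> rho <= B ->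
      eps <= t <= 1 - eps -> eta <= `|u - v| ->
      `|(1 - t) *: u + t *: v| <= rho - delta.
Proof.
move=> eps0 eta0.
(* A positive bound for [rho], whatever the sign of [B]: after rescaling, the distance is still at
   least [eta / C]. *)
pose C := Num.max B 1.
have C0 : 0 < C by rewrite lt_max ltr01 orbT.
have [delta delta0 ball] := uniformly_convex_unit_ball (divr_gt0 eta0 C0).
exists (eta * eps * delta) => [|u v rho t ur vr rB /andP[te te1] uv].
  by rewrite !mulr_gt0.
have uv2 := le_trans uv (ler_normB u v).
have rho0 : 0 < rho by lra.
have mid : `|2^-1 *: (u + v)| <= rho * (1 - delta).
  have scale (w : E) : `|w| <= rho -> `|rho^-1 *: w| <= 1.
    move=> wr.
    by rewrite normrZ gtr0_norm ?invr_gt0// mulrC ler_pdivrMr// mul1r.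
  have unscale (w : E) : `|w| = rho * `|rho^-1 *: w|.
    by rewrite normrZ gtr0_norm ?invr_gt0// mulrA divff ?mul1r// gt_eqF.
  rewrite unscale ler_pM2l// scalerA mulrC -scalerA scalerDr.
  apply: ball; [exact: scale|exact: scale|].
  rewrite -scalerBr ler_pdivrMr// (le_trans uv)// [leLHS]unscale mulrC.
  by rewrite ler_wpM2l// (le_trans rB)// le_max lexx.
(* Since [eta <= |u - v| <= 2 * rho], the gain proportional to [rho] is bounded below independently
   of [rho]. *)
have gain : eta * eps * delta <= rho * (2 * eps * delta).
  have -> : eta * eps * delta = eta * (eps * delta) by ring.
  have -> : rho * (2 * eps * delta) = (2 * rho) * (eps * delta) by ring.
  by rewrite ler_wpM2r ?mulr_ge0//; lra.
have slide s (w w' : E) : eps <= s -> s <= 2^-1 -> `|w| <= rho ->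
    `|2^-1 *: (w + w')| <= rho * (1 - delta) ->
    `|(1 - s) *: w + s *: w'| <= rho - eta * eps * delta.
  move=> es s2 wr m.
  have -> : (1 - s) *: w + s *: w' =
      (1 - 2 * s) *: w + (2 * s) *: (2^-1 *: (w + w')).
    rewrite scalerA scalerDr addrA -scalerDl.
    by congr (_ *: _ + _ *: _); field.
  apply: le_trans (ler_normD _ _) _.
  rewrite (normrZ (1 - 2 * s)) (normrZ (2 * s)) !ger0_norm; try lra.
  have a1 : (1 - 2 * s) * `|w| <= (1 - 2 * s) * rho by rewrite ler_wpM2l//; lra.
  have a2 : 2 * s * `|2^-1 *: (w + w')| <= 2 * s * (rho * (1 - delta)).
    by rewrite ler_wpM2l//; lra.
  have a3 : rho * (2 * eps * delta) <= rho * (2 * s * delta).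
    by rewrite ler_pM2l// ler_pM2r//; lra.
  lra.
have [t2|t2] := leP t 2^-1; first exact: slide.
have := slide (1 - t) v u; rewrite subKr [t *: v + _]addrC [v + u]addrC.
by apply => //; lra.
Qed.

(* Schu's lemma *)
Lemma uniformly_convex_cvg (u v : nat -> E) (rho t : nat -> R) (r eps : R) :
  0 < eps -> (forall n, eps <= t n <= 1 - eps) ->
  (forall n, `|u n| <= rho n) -> (forall n, `|v n| <= rho n) ->
  rho n @[n --> \oo] --> r ->
  `|(1 - t n) *: u n + t n *: v n| @[n --> \oo] --> r ->
  `|u n - v n| @[n --> \oo] --> (0 : R).
Proof.
move=> eps0 tP ur vr rhor combr; apply/cvgr0Pnorm_lt => eta eta0.
(* Eventually [rho n <= r + 1]. With both limits reached within [delta / 2], a distance of at least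
   [eta] would push the combination below [r - delta / 2], a contradiction. *)
have [delta delta0 comb] := uniformly_convex_comb (r + 1) eps0 eta0.
have d2 : 0 < delta / 2 by lra.
move/cvgrPdist_lt: rhor => rhor; move/cvgrPdist_lt: combr => combr.
near=> n.
have r1 : `|r - rho n| < 1 by near: n; exact: rhor.
have r2 : `|r - rho n| < delta / 2 by near: n; exact: rhor.
have r3 : `|r - `|(1 - t n) *: u n + t n *: v n| | < delta / 2.
  by near: n; exact: combr.
rewrite normr_id ltNge; apply/negP => far.
move: r1 r2 r3; rewrite !ltr_norml => r1 r2 r3.
have := comb _ _ _ _ (ur n) (vr n) _ (tP n) far; lra.
Unshelve. all: by end_near. Qed.

End UniformConvexity.

(** * Real sequences decreasing up to summable perturbations *)

Section PerturbedDecrease.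
Variables (R : realType) (D c d : nat -> R).
Hypotheses (D0 : forall n, 0 <= D n) (c0 : forall n, 0 <= c n)
  (d0 : forall n, 0 <= d n)
  (DS : forall n, D n.+1 <= expR (c n) * D n + d n)
  (cc : cvgn (series c)) (cd : cvgn (series d)).

Let nd_series (u : nat -> R) :
  (forall n, 0 <= u n) -> nondecreasing_seq (series u).
Proof. by move=> u0; apply: nondecreasing_series => n _ _; exact: u0. Qed.

Let series_ge0 (u : nat -> R) n : (forall n, 0 <= u n) -> 0 <= series u n.
Proof. by move=> u0; rewrite /series/=; apply: sumr_ge0. Qed.

(** Discounting [D] by the accumulated growth and subtracting the accumulated errors leaves a
    monotone quantity, from which [D] can be recovered. *)
Let W n := expR (- series c n) * D n - series d n.

Let W_nonincreasing : nonincreasing_seq W.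
Proof.
apply/nonincreasing_seqP => n; rewrite /W !seriesSr.
have h : expR (- (series c n + c n)) * D n.+1 <=
    expR (- series c n) * D n + expR (- (series c n + c n)) * d n.
  have -> : expR (- series c n) = expR (- (series c n + c n)) * expR (c n).
    by rewrite -expRD; congr expR; ring.
  by rewrite -mulrA -mulrDr ler_wpM2l ?expR_ge0.
have e1 : expR (- (series c n + c n)) * d n <= d n.
  by rewrite ler_piMl// expR_le1 oppr_le0 addr_ge0 ?series_ge0.
lra.
Qed.

(** [W] is nonincreasing and bounded below by minus the sum of [d], so it converges; [D] is a
    continuous expression in [W] and the two convergent partial sums. *)
Lemma perturbed_decrease_cvg : cvgn D.
Proof.
have cW : cvgn W.
  apply: nonincreasing_is_cvgn => //; exists (- limn (series d)) => _ [n _ <-].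
  have dn : series d n <= limn (series d).
    by apply: nondecreasing_cvgn_le => //; exact: nd_series.
  have : 0 <= expR (- series c n) * D n by rewrite mulr_ge0 ?expR_ge0.
  by rewrite /W; lra.
have -> : D = (fun n => expR (series c n) * (W n + series d n)).
  by apply/funext => n; rewrite /W subrK mulrA -expRD subrr expR0 mul1r.
apply: is_cvgM; last exact: is_cvgD.
apply: cvgP; apply: continuous_cvg; last exact: cc.
exact: continuous_expR.
Qed.

(** Follows from [W m <= W n]. The factor depends on neither [n] nor [m], so a small [D n] with a
    small tail of [d] controls all later terms. *)
Lemma perturbed_decrease_le n m : (n <= m)%N ->
  D m <= expR (limn (series c)) * (D n + (limn (series d) - series d n)).
Proof.
move=> nm.
have dm : series d m <= limn (series d).
  by apply: nondecreasing_cvgn_le => //; exact: nd_series.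
have cm : series c m <= limn (series c).
  by apply: nondecreasing_cvgn_le => //; exact: nd_series.
have -> : D m = expR (series c m) * (W m + series d m).
  by rewrite /W subrK mulrA -expRD subrr expR0 mul1r.
have Dn : expR (- series c n) * D n <= D n.
  by rewrite ler_piMl// expR_le1 oppr_le0 series_ge0.
have Wm : W m + series d m <= D n + (limn (series d) - series d n).
  by have := W_nonincreasing nm; rewrite {2}/W; lra.
apply: ler_pM; rewrite ?expR_ge0 ?ler_expR//.
by rewrite /W subrK mulr_ge0 ?expR_ge0.
Qed.

End PerturbedDecrease.

(** * Convex combinations and squeezing *)

Lemma convex_comb_in (R : realType) (E : normedModType R) (K : set E) (u v : E)
    (t : R) : convex_set (K : set (convex_lmodType E)) ->
  0 <= t <= 1 -> K u -> K v -> K ((1 - t) *: u + t *: v).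
Proof.
move=> Kc t01 Ku Kv.
have := Kc v u (Itv01 (andP t01).1 (andP t01).2).
rewrite !inE addrC; exact.
Qed.

Lemma norm_comb_le (R : realType) (E : normedModType R) (u v : E) (t a : R) :
  0 <= t <= 1 -> `|u| <= a -> `|v| <= a -> `|(1 - t) *: u + t *: v| <= a.
Proof.
move=> /andP[t0 t1] ua va; apply: le_trans (ler_normD _ _) _.
rewrite !normrZ !ger0_norm ?subr_ge0//.
have : (1 - t) * `|u| <= (1 - t) * a by rewrite ler_wpM2l ?subr_ge0.
have : t * `|v| <= t * a by rewrite ler_wpM2l.
lra.
Qed.

Lemma squeeze_cvgr0 (R : realType) (u h : nat -> R) :
  (forall n, 0 <= u n <= h n) -> h n @[n --> \oo] --> (0 : R) ->
  u n @[n --> \oo] --> (0 : R).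
Proof.
move=> uh h0; apply: (squeeze_cvgr _ (cvg_cst 0) h0).
by apply: nearW => n; exact: uh.
Qed.

(** * Convergence of quasi-Fejér sequences *)

(** As [c] and [d] are the same for every [p], once [x n] is close to some point of [F] the whole
    tail stays close to that point; hence [x] is Cauchy. *)
Lemma quasi_fejer_cvg (R : realType) (E : completeNormedModType R) (F : set E)
    (x : nat -> E) (c d : nat -> R) :
  (forall n, 0 <= c n) -> (forall n, 0 <= d n) ->
  cvgn (series c) -> cvgn (series d) ->
  (forall p n, F p -> `|x n.+1 - p| <= expR (c n) * `|x n - p| + d n) ->
  F !=set0 -> dist_set (x n) F @[n --> \oo] --> (0 : R) ->
  exists2 q, x n @[n --> \oo] --> q & closure F q.
Proof.
move=> c0 d0 cc cd xS [p0 Fp0] dist0.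
have near_F e n : dist_set (x n) F < e -> exists2 p, F p & `|x n - p| < e.
  move=> xe; have e0 : 0 < e - dist_set (x n) F by rewrite subr_gt0.
  have [|_ [p Fp <-]] := inf_adherent e0 (E := [set `|x n - p| | p in F]).
    split; first by exists `|x n - p0|, p0.
    by exists 0 => _ [p _ <-].
  by rewrite subrKC; exists p.
have cx : cvgn x.
  apply/cauchy_cvgP/cauchy_exP => e e0.
  (* The distance to [p] and the tail of [d] each get [e / (2 * C)], which amplification by [C]
     turns into [e] in total. The ball containing the tail of [x] is centred at [p]. *)
  pose C := expR (limn (series c)).
  have eC : 0 < e / (2 * C) by rewrite divr_gt0 ?mulr_gt0 ?expR_gt0.
  have [n [xn tail]] : exists n, dist_set (x n) F < e / (2 * C) /\
      limn (series d) - series d n < e / (2 * C).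
    near \oo => n; exists n; split; near: n.
      by move/cvgr_lt : dist0; apply.
    move/cvgrPdist_lt : cd => /(_ _ eC); apply: filterS => n.
    exact/le_lt_trans/ler_norm.
  have [p Fp xp] := near_F _ _ xn.
  exists p; exists n => // m /= nm; rewrite -ball_normE /= distrC.
  have := perturbed_decrease_le (fun k => normr_ge0 (x k - p)) c0 d0
    (fun k => xS p k Fp) cc cd nm.
  move/le_lt_trans; apply.
  have -> : e = C * (e / (2 * C) + e / (2 * C)).
    by field; rewrite gt_eqF ?expR_gt0.
  by rewrite ltr_pM2l ?expR_gt0// ltrD.
exists (limn x) => // B /nbhs_ballP[e /= e0 eB].
have e2 : 0 < e / 2 by rewrite divr_gt0.
near \oo => n.
have [p Fp xp] : exists2 p, F p & `|x n - p| < e / 2.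
  by apply: near_F; near: n; move/cvgr_lt : dist0; apply.
exists p; split=> //; apply: eB; rewrite -ball_normE /=.
have : `|limn x - x n| < e / 2 by near: n; move/cvgrPdist_lt : cx; apply.
by have := ler_distD (x n) (limn x) p; lra.
Unshelve. all: by end_near. Qed.

(** * Asymptotic regularity of the two-step iteration *)

(** Write [iter n.+2 S] as [S] after [iter n.+1 S]: the Lipschitz bound on [S] reduces the claim at
    [x n.+1] to the distance from [x n.+1] to [iter n.+1 S (x n.+1)], which is compared with the
    same distance at [x n]. *)
Lemma iter_regular (R : realType) (E : normedModType R) (K : set E)
    (S : E -> E) (L : R) (x : nat -> E) :
  0 <= L -> (forall u, K u -> K (S u)) ->
  (forall n u v, K u -> K v ->
    `|iter n.+1 S u - iter n.+1 S v| <= L * `|u - v|) ->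
  (forall n, K (x n)) ->
  `|x n - iter n.+1 S (x n)| @[n --> \oo] --> (0 : R) ->
  `|x n.+1 - x n| @[n --> \oo] --> (0 : R) ->
  `|x n - S (x n)| @[n --> \oo] --> (0 : R).
Proof.
move=> L0 SK lip xK; set G := fun n => `|x n - iter n.+1 S (x n)| => G0.
set U := fun n => `|x n.+1 - x n| => U0.
have iterK n u : K u -> K (iter n S u).
  by move=> Ku; elim: n => //= n; exact: SK.
rewrite -cvg_shiftS.
apply: (@squeeze_cvgr0 _ _ (fun n => G n.+1 + L * ((1 + L) * U n + G n))).
  move=> n; rewrite normr_ge0 /=.
  have h1 := ler_distD (iter n.+2 S (x n.+1)) (x n.+1) (S (x n.+1)).
  have h2 : `|iter n.+2 S (x n.+1) - S (x n.+1)| <=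
      L * `|iter n.+1 S (x n.+1) - x n.+1|.
    exact: (lip 0%N _ _ (iterK n.+1 _ (xK n.+1)) (xK n.+1)).
  have h3 := ler_distD (iter n.+1 S (x n)) (iter n.+1 S (x n.+1)) (x n.+1).
  have h4 := ler_distD (x n) (iter n.+1 S (x n)) (x n.+1).
  have h5 : L * `|iter n.+1 S (x n.+1) - x n.+1| <= L * ((1 + L) * U n + G n).
    rewrite ler_wpM2l//; have := lip n _ _ (xK n.+1) (xK n).
    move: h3 h4; rewrite [`|iter n.+1 S (x n) - x n|]distrC.
    rewrite [`|x n - x n.+1|]distrC.
    by rewrite -/(G n) -/(U n); lra.
  by move: h1; rewrite -/(G n.+1); lra.
have -> : 0 = 0 + L * ((1 + L) * 0 + 0) :> R by ring.
apply: cvgD; first by move: G0; rewrite -(cvg_shiftS G).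
apply: cvgMr; apply: cvgD => //; exact: cvgMr.
Qed.

Section Iteration.
Variables (R : realType) (E : normedModType R) (K F : set E) (S1 S2 : E -> E).
Variables (L eps : R) (a b alpha beta : nat -> R) (x y : nat -> E).
Hypothesis ucE : uniformly_convex E.
Hypothesis Kconvex : convex_set (K : set (convex_lmodType E)).
Hypotheses (S1K : forall u, K u -> K (S1 u)) (S2K : forall u, K u -> K (S2 u)).
Hypothesis L0 : 0 <= L.
Hypotheses
  (lip1 : forall n u v, K u -> K v ->
    `|iter n.+1 S1 u - iter n.+1 S1 v| <= L * `|u - v|)
  (lip2 : forall n u v, K u -> K v ->
    `|iter n.+1 S2 u - iter n.+1 S2 v| <= L * `|u - v|).
Hypotheses (a0 : forall n, 0 <= a n) (b0 : forall n, 0 <= b n).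
Hypotheses (ca : cvgn (series a)) (cb : cvgn (series b)).
Hypotheses
  (quasi1 : forall n u p, K u -> F p ->
    `|iter n.+1 S1 u - p| <= (1 + a n) * `|u - p| + b n)
  (quasi2 : forall n u p, K u -> F p ->
    `|iter n.+1 S2 u - p| <= (1 + a n) * `|u - p| + b n).
Hypotheses (eps0 : 0 < eps)
  (alphaP : forall n, eps <= alpha n <= 1 - eps)
  (betaP : forall n, eps <= beta n <= 1 - eps).
Hypothesis x0K : K (x 0%N).
Hypothesis xS : forall n,
  x n.+1 = (1 - alpha n) *: iter n.+1 S1 (y n) + alpha n *: iter n.+1 S2 (y n).
Hypothesis yE : forall n,
  y n = (1 - beta n) *: x n + beta n *: iter n.+1 S1 (x n).

Let unit_weight (t : R) : eps <= t <= 1 - eps -> 0 <= t <= 1.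
Proof.
move=> /andP[et te]; rewrite (le_trans (ltW eps0) et) (le_trans te)//.
by rewrite gerBl ltW.
Qed.

Let iterK S n u : (forall u, K u -> K (S u)) -> K u -> K (iter n S u).
Proof. by move=> SK Ku; elim: n => //= n; exact: SK. Qed.

Let combB (t : R) (u v p : E) :
  (1 - t) *: u + t *: v - p = (1 - t) *: (u - p) + t *: (v - p).
Proof.
by rewrite !scalerBr addrACA -opprD -scalerDl subrK scale1r.
Qed.

Let yK_of_xK n : K (x n) -> K (y n).
Proof.
move=> xK; rewrite yE; apply: convex_comb_in => //; first exact: unit_weight.
exact: iterK.
Qed.

Lemma iteration_in n : K (x n).
Proof.
elim: n => // n xK; have yK := yK_of_xK xK; rewrite xS.
by apply: convex_comb_in => //; [exact: unit_weight|exact: iterK|exact: iterK].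
Qed.

Let xK := iteration_in.
Let yK n : K (y n). Proof. exact: yK_of_xK. Qed.

Section FixedPoint.
Variable p : E.
Hypothesis Fp : F p.

(** [g] bounds the distances to [p] after one application of the iterates and [h] after two. Both
    tend to the limit of [|x n - p|], so they serve as radii in Schu's lemma. *)
Let g n := (1 + a n) * `|x n - p| + b n.
Let h n := (1 + a n) * g n + b n.

Let S1x_le n : `|iter n.+1 S1 (x n) - p| <= g n.
Proof. exact: quasi1. Qed.

Let le_g (r s : R) n : 0 <= r -> r <= s -> r <= (1 + a n) * s + b n.
Proof.
move=> r0 rs; have := b0 n.
have : 0 <= a n * s by rewrite mulr_ge0// (le_trans r0).
lra.
Qed.

Let x_le n : `|x n - p| <= g n.
Proof. exact: le_g. Qed.

Let y_le n : `|y n - p| <= g n.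
Proof. by rewrite yE combB; apply: norm_comb_le => //; exact: unit_weight. Qed.

Let gh n : (1 + a n) * `|y n - p| + b n <= h n.
Proof. by rewrite /h lerD2r ler_wpM2l ?addr_ge0. Qed.

Let S1y_le n : `|iter n.+1 S1 (y n) - p| <= h n.
Proof. by apply: le_trans (gh n); exact: quasi1. Qed.

Let S2y_le n : `|iter n.+1 S2 (y n) - p| <= h n.
Proof. by apply: le_trans (gh n); exact: quasi2. Qed.

(** Placed before the limit [r] is assumed, since this recurrence is what yields that limit. *)
Lemma iteration_step_le n : `|x n.+1 - p| <=
  (1 + a n) * ((1 + a n) * `|x n - p| + b n) + b n.
Proof. by rewrite xS combB; apply: norm_comb_le => //; exact: unit_weight. Qed.

Let D n := `|x n - p|.
Variable r : R.
Hypothesis Dr : D n @[n --> \oo] --> r.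

Let a_0 : a n @[n --> \oo] --> (0 : R). Proof. exact: cvg_series_cvg_0. Qed.
Let b_0 : b n @[n --> \oo] --> (0 : R). Proof. exact: cvg_series_cvg_0. Qed.

Let affine_cvg (u : nat -> R) : u n @[n --> \oo] --> r ->
  (1 + a n) * u n + b n @[n --> \oo] --> r.
Proof.
move=> ur; have -> : r = (1 + 0) * r + 0 by ring.
by apply: cvgD => //; apply: cvgM => //; apply: cvgD => //; exact: cvg_cst.
Qed.

Let g_r : g n @[n --> \oo] --> r. Proof. exact: affine_cvg. Qed.
Let h_r : h n @[n --> \oo] --> r. Proof. exact: affine_cvg. Qed.

Let Z n := `|iter n.+1 S1 (y n) - iter n.+1 S2 (y n)|.

(** Schu's lemma with weights [alpha] and radii [h]: the combination is [x n.+1 - p], whose norm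
    tends to [r]. *)
Let Z_0 : Z n @[n --> \oo] --> (0 : R).
Proof.
have := uniformly_convex_cvg ucE eps0 alphaP S1y_le S2y_le h_r.
under eq_fun do rewrite -combB -xS.
move=> /(_ _)/wrap[]; first by move: Dr; rewrite -(cvg_shiftS D).
by under eq_fun do rewrite opprB addrA subrK.
Qed.

Let xS_S1y n : `|x n.+1 - iter n.+1 S1 (y n)| <= Z n.
Proof.
have /andP[t0 t1] := unit_weight (alphaP n).
rewrite xS combB subrr scaler0 add0r normrZ ger0_norm// distrC.
by rewrite ler_piMl.
Qed.

(** The lower bound comes from [D n.+1 <= Z n + (1 + a n) * |y n - p| + b n], solved for
    [|y n - p|]. This limit is the input of the second use of Schu's lemma. *)
Let y_r : `|y n - p| @[n --> \oo] --> r.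
Proof.
apply: (@squeeze_cvgr _ _ _ _ (fun n => (D n.+1 - Z n - b n) / (1 + a n)) g).
- apply: nearW => n; rewrite y_le andbT ler_pdivrMr ?ltr_pwDl// mulrC.
  have := quasi1 n (yK n) Fp.
  have := ler_distD (iter n.+1 S1 (y n)) (x n.+1) p.
  by have := xS_S1y n; rewrite /D; lra.
- have -> : r = (r - 0 - 0) / (1 + 0) by field.
  apply: cvgM.
    apply: cvgB => //; apply: cvgB => //.
    by move: Dr; rewrite -(cvg_shiftS D).
  apply: cvgV; first by rewrite addr0.
  by apply: cvgD => //; exact: cvg_cst.
- exact: g_r.
Qed.

Let V n := `|x n - iter n.+1 S1 (x n)|.

(** Schu's lemma with weights [beta] and radii [g], the combination being [y n - p]. *)
Let V_0 : V n @[n --> \oo] --> (0 : R).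
Proof.
have := uniformly_convex_cvg ucE eps0 betaP x_le S1x_le g_r.
under eq_fun do rewrite -combB -yE.
move=> /(_ y_r).
by under eq_fun do rewrite opprB addrA subrK.
Qed.

Let xy_le n : `|x n - y n| <= V n.
Proof.
have /andP[t0 t1] := unit_weight (betaP n).
rewrite distrC yE.
rewrite combB subrr scaler0 add0r normrZ ger0_norm// distrC.
by rewrite ler_piMl.
Qed.

Let x_S1y n : `|x n - iter n.+1 S1 (y n)| <= (1 + L) * V n.
Proof.
have := ler_distD (iter n.+1 S1 (x n)) (x n) (iter n.+1 S1 (y n)).
have := lip1 n (xK n) (yK n).
have := ler_wpM2l L0 (xy_le n).
by rewrite -/(V n); lra.
Qed.

Let U_0 : `|x n.+1 - x n| @[n --> \oo] --> (0 : R).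
Proof.
apply: (@squeeze_cvgr0 _ _ (fun n => Z n + (1 + L) * V n)).
  move=> n; rewrite normr_ge0 /=.
  have := ler_distD (iter n.+1 S1 (y n)) (x n.+1) (x n).
  have := xS_S1y n; have := x_S1y n; rewrite [`|x n - _|]distrC; lra.
have -> : 0 = 0 + (1 + L) * 0 :> R by ring.
by apply: cvgD => //; exact: cvgMr.
Qed.

(** The path through the [S1]- and [S2]-iterates of [y n] costs [(1 + L) * V n], then [Z n], then
    [L * V n]. *)
Let x_S2x : `|x n - iter n.+1 S2 (x n)| @[n --> \oo] --> (0 : R).
Proof.
apply: (@squeeze_cvgr0 _ _ (fun n => Z n + (1 + 2 * L) * V n)).
  move=> n; rewrite normr_ge0 /=.
  have := ler_distD (iter n.+1 S1 (y n)) (x n) (iter n.+1 S2 (x n)).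
  have := ler_distD (iter n.+1 S2 (y n)) (iter n.+1 S1 (y n))
    (iter n.+1 S2 (x n)).
  have := lip2 n (yK n) (xK n); rewrite [`|y n - x n|]distrC.
  have := ler_wpM2l L0 (xy_le n); have := x_S1y n; rewrite -/(Z n); lra.
have -> : 0 = 0 + (1 + 2 * L) * 0 :> R by ring.
by apply: cvgD => //; exact: cvgMr.
Qed.

Lemma iteration_regular :
  `|x n - S1 (x n)| @[n --> \oo] --> (0 : R) /\
  `|x n - S2 (x n)| @[n --> \oo] --> (0 : R).
Proof.
by split; [apply: (iter_regular L0 S1K)|apply: (iter_regular L0 S2K)].
Qed.

End FixedPoint.

End Iteration.

(** * Consequences of the hypotheses on the nonself mappings *)

(** For [q] in the closure and a fixed point [p] near it, [|T q - q| <= (L + 1) * |q - p|];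
    closedness of [K] puts [q] where the Lipschitz bound holds. *)
Lemma closed_fixed_points (R : realType) (E : normedModType R) (K : set E)
    (T : E -> E) (L : R) :
  closed K -> 0 <= L ->
  (forall u v, K u -> K v -> `|T u - T v| <= L * `|u - v|) ->
  closed (fixed_points K T).
Proof.
move=> Kc L0 lip q clq.
have Kq : K q by apply: Kc; apply: closureS clq => ? [].
split=> //; apply/eqP; rewrite -subr_eq0 -normr_le0; apply/ler_addgt0Pr => e e0.
have eL : 0 < e / (L + 1) by rewrite divr_gt0// ltr_wpDl.
have [p [[Kp Tp]]] := clq _ (nbhsx_ballx q _ eL).
rewrite -ball_normE /= ltr_pdivlMr ?ltr_wpDl// => qp.
rewrite add0r; apply: le_trans (ltW qp).
have := ler_distD p (T q) q; have := lip _ _ Kq Kp.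
by rewrite Tp [`|p - q|]distrC; lra.
Qed.

Lemma iterates_lipschitz (R : realType) (E : normedModType R) (K : set E)
    (P T : E -> E) (L : R) :
  nonexpansive_retraction K P -> uniformly_lipschitzian K P L T ->
  forall n u v, K u -> K v ->
    `|iter n.+1 (P \o T) u - iter n.+1 (P \o T) v| <= L * `|u - v|.
Proof.
move=> [_ Pne _] [_ lip] n u v Ku Kv.
exact: le_trans (Pne _ _) (lip u v n.+1 Ku Kv isT).
Qed.

(** On nonnegative reals [phi s <= phi M + Mstar * s], by monotonicity below [M] and by the growth
    bound above it. This makes the perturbation affine in the distance. *)
Lemma iterates_quasi_nonexpansive (R : realType) (E : normedModType R)
    (K : set E) (P T : E -> E) (mu lambda : nat -> R) (phi : R -> R)
    (M Mstar : R) :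
  nonexpansive_retraction K P ->
  total_asymptotically_nonexpansive K P mu lambda phi T ->
  0 < M -> 0 < Mstar -> (forall k, M <= k -> phi k <= Mstar * k) ->
  forall n u p, K u -> fixed_points K T p ->
    `|iter n.+1 (P \o T) u - p| <=
      (1 + Mstar * mu n.+1) * `|u - p| + (phi M * mu n.+1 + lambda n.+1).
Proof.
move=> [_ _ Pid] [mul0 _ [phi_homo _ phi0] tan] M0 Ms0 phiM n u p Ku [Kp Tp].
have [mu0 _] := mul0 n.+1 isT.
have iterp : iter n.+1 (P \o T) p = p.
  by apply: iter_fix; rewrite /= Tp Pid.
have phi_le s : 0 <= s -> phi s <= phi M + Mstar * s.
  move=> s0; have [/phiM sM|/phi_homo sM] := leP M s.
    by have := phi_homo _ _ M0; rewrite phi0; lra.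
  by have := mulr_ge0 (ltW Ms0) s0; lra.
have := tan u p n.+1 Ku Kp isT; rewrite iterp.
have := ler_wpM2l mu0 (phi_le _ (normr_ge0 (u - p))).
lra.
Qed.

(** A distance of at least [e] would force [f e <= s n], while eventually [s n < f e]. *)
Lemma dist_set_cvg0 (R : realType) (E : normedModType R) (F : set E)
    (f : R -> R) (x : nat -> E) (s : nat -> R) :
  (forall s t, 0 <= s -> s <= t -> f s <= f t) ->
  (forall t, 0 < t -> 0 < f t) -> F !=set0 ->
  (forall n, f (dist_set (x n) F) <= s n) -> s n @[n --> \oo] --> (0 : R) ->
  dist_set (x n) F @[n --> \oo] --> (0 : R).
Proof.
move=> fnd fpos [p Fp] fs s0; apply/cvgr0Pnorm_lt => e e0.
near=> n.
have dist0 : 0 <= dist_set (x n) F.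
  apply: lb_le_inf; first by exists `|x n - p|, p.
  by move=> _ [q _ <-].
rewrite ger0_norm// ltNge; apply/negP => /(fnd _ _ (ltW e0)).
apply/negP; rewrite -ltNge (le_lt_trans (fs n))//.
by near: n; move/cvgr_lt : s0; apply; exact: fpos.
Unshelve. all: by end_near. Qed.

(** * Strong convergence to a common fixed point *)

Theorem theorem3 (R : realType) (E : completeNormedModType R)
    (K : set E) (P T1 T2 : E -> E) (L : R)
    (mu lambda : nat -> R) (phi : R -> R)
    (alpha beta : nat -> R) (x y : nat -> E) :
  uniformly_convex E -> smooth E ->
  K !=set0 -> closed K -> convex_set (K : set (convex_lmodType E)) ->
  nonexpansive_retraction K P -> sunny P ->
  weakly_inward K T1 -> weakly_inward K T2 ->
  uniformly_lipschitzian K P L T1 -> uniformly_lipschitzian K P L T2 ->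
  total_asymptotically_nonexpansive K P mu lambda phi T1 ->
  total_asymptotically_nonexpansive K P mu lambda phi T2 ->
  cvg ((\sum_(1 <= k < n.+1) mu k) @[n --> \oo]) ->
  cvg ((\sum_(1 <= k < n.+1) lambda k) @[n --> \oo]) ->
  (exists M Mstar : R, [/\ 0 < M, 0 < Mstar &
     forall kappa, M <= kappa -> phi kappa <= Mstar * kappa]) ->
  (exists eps : R, [/\ 0 < eps, eps < 1 &
     forall n, (1 <= n)%N ->
       (eps <= alpha n <= 1 - eps) /\ (eps <= beta n <= 1 - eps)]) ->
  K (x 1%N) ->
  (forall n, (1 <= n)%N ->
     x n.+1 = (1 - alpha n) *: iter n (P \o T1) (y n)
              + alpha n *: iter n (P \o T2) (y n)) ->
  (forall n, (1 <= n)%N ->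
     y n = (1 - beta n) *: x n + beta n *: iter n (P \o T1) (x n)) ->
  condition_A' K P T1 T2 ->
  fixed_points K T1 `&` fixed_points K T2 !=set0 ->
  exists2 p : E, (fixed_points K T1 `&` fixed_points K T2) p &
    x n @[n --> \oo] --> p.
Proof.
move=> ucE _ _ Kclosed Kconvex Pret _ _ _ lip1 lip2 tan1 tan2 cmu clam.
move=> [M [Mstar [M0 Ms0 phiM]]] [eps [eps0 _ weights]] x1K xS yE.
move=> [f [fnd _ fpos fA]] F0.
set F := _ `&` _ in fA F0 *.
have [PK _ _] := Pret; have [L0 lipT1] := lip1; have [_ lipT2] := lip2.
have [mul0 _ [phi_homo _ phi0] _] := tan1.
(* From here on sequences are shifted by one, so that the unconstrained values at index 0 never
   enter. *)
pose a n := Mstar * mu n.+1.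
pose b n := phi M * mu n.+1 + lambda n.+1.
have phiM0 : 0 < phi M by rewrite -phi0; exact: phi_homo.
have a0 n : 0 <= a n.
  by rewrite mulr_ge0 ?(ltW Ms0)//; have [] := mul0 n.+1 isT.
have b0 n : 0 <= b n.
  by have [? ?] := mul0 n.+1 isT; rewrite addr_ge0// mulr_ge0 ?(ltW phiM0).
have shift_series (u : nat -> R) :
    cvg ((\sum_(1 <= k < n.+1) u k) @[n --> \oo]) ->
    cvgn (series (fun n => u n.+1)).
  rewrite (_ : (fun n => _) = series (fun n => u n.+1))//.
  by apply/funext => n; rewrite big_add1.
have {}cmu := shift_series _ cmu; have {}clam := shift_series _ clam.
have ca : cvgn (series a) by exact: (is_cvg_seriesZ (k := Mstar) cmu).
have cb : cvgn (series b).
  exact: is_cvg_seriesD (is_cvg_seriesZ (k := phi M) cmu) clam.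
have quasi1 n u p : K u -> F p -> `|iter n.+1 (P \o T1) u - p| <=
    (1 + a n) * `|u - p| + b n.
  move=> Ku [Fp _].
  exact: (iterates_quasi_nonexpansive Pret tan1 M0 Ms0 phiM).
have quasi2 n u p : K u -> F p -> `|iter n.+1 (P \o T2) u - p| <=
    (1 + a n) * `|u - p| + b n.
  move=> Ku [_ Fp].
  exact: (iterates_quasi_nonexpansive Pret tan2 M0 Ms0 phiM).
have S1K u : K u -> K ((P \o T1) u) by move=> _; exact: PK.
have S2K u : K u -> K ((P \o T2) u) by move=> _; exact: PK.
have alphaP n := (weights n.+1 isT).1; have betaP n := (weights n.+1 isT).2.
have xS' n := xS n.+1 isT; have yE' n := yE n.+1 isT.
have L0' := ltW L0.
have lipS1 := iterates_lipschitz Pret lip1.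
have lipS2 := iterates_lipschitz Pret lip2.
have xK := iteration_in Kconvex S1K S2K eps0 alphaP betaP x1K xS' yE'.
have [A A0 aA] : exists2 A, 0 <= A & forall n, a n <= A.
  have [A [_ aA]] := cvg_series_bounded ca.
  exists (`|A| + 1) => [|n]; first by rewrite addr_ge0.
  have := aA (`|A| + 1); rewrite ltr_pwDr ?ler_norm// => /(_ isT n I).
  exact/le_trans/ler_norm.
(* Uses [(1 + a n)^2 <= expR (2 * a n)], and the uniform bound [A] on [a] to absorb
   [(1 + a n) * b n + b n]; no coefficient depends on [p]. *)
have step p n : F p -> `|x n.+2 - p| <=
    expR (2 * a n) * `|x n.+1 - p| + (2 + A) * b n.
  move=> Fp.
  apply: le_trans (iteration_step_le Kconvex S1K S2K a0 b0 quasi1 quasi2 eps0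
    alphaP betaP x1K xS' yE' Fp n) _.
  rewrite mulrDr mulrA -addrA lerD//.
    rewrite ler_wpM2r// mulr_natl mulr2n expRD.
    by rewrite ler_pM ?addr_ge0// expR_ge1Dx.
  by have := ler_wpM2r (b0 n) (aA n); lra.
have c0 n : 0 <= 2 * a n by rewrite mulr_ge0.
have d0 n : 0 <= (2 + A) * b n by rewrite mulr_ge0// addr_ge0.
have cc : cvgn (series (fun n => 2 * a n)).
  exact: (is_cvg_seriesZ (k := 2) ca).
have cd : cvgn (series (fun n => (2 + A) * b n)).
  exact: (is_cvg_seriesZ (k := 2 + A) cb).
(* For regularity, the limit of the distances to one common fixed point is enough. *)
have [p0 Fp0] := F0.
have Dr := perturbed_decrease_cvg (fun n => normr_ge0 (x n.+1 - p0)) c0 d0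
  (fun n => step p0 n Fp0) cc cd.
have [reg1 reg2] := iteration_regular ucE Kconvex S1K S2K L0' lipS1 lipS2
  a0 b0 ca cb quasi1 quasi2 eps0 alphaP betaP x1K xS' yE' Fp0 Dr.
have dist0 : dist_set (x n.+1) F @[n --> \oo] --> (0 : R).
  apply: (dist_set_cvg0 fnd fpos F0 (fun n => fA _ (xK n))).
  have -> : 0 = 2^-1 * (0 + 0) :> R by ring.
  by apply: cvgMr; exact: cvgD.
have [q xq clq] := quasi_fejer_cvg c0 d0 cc cd step F0 dist0.
exists q; last by rewrite -cvg_shiftS.
(* At [n = 1] the inner iterate is the identity, so the uniform bound makes [T1] and [T2] themselves
   Lipschitz on [K]. *)
have Fclosed : closed F.
  apply: closedI; apply: (closed_fixed_points Kclosed L0') => u v Ku Kv.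
    exact: (lipT1 u v 1%N).
  exact: (lipT2 u v 1%N).
exact: Fclosed.
Qed.
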